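(* Let $\mathfrak{F}$ be a surface in $E^3$ of class $C^r$, $r\ge 4$, without parabolic points and which is not a canal surface, with principal curvatures $k_1,k_2$. Consider the two nets on $\mathfrak{F}$ corresponding to the asymptotic lines of the central surfaces $\mathfrak{F}^{(1)}$ and $\mathfrak{F}^{(2)}$, respectively, namely $$\nabla_1 k_1\,\omega_1^2-\nabla_1k_2\,\omega_2^2=0\qquad\text{and}\qquad \nabla_2 k_1\,\omega_1^2-\nabla_2k_2\,\omega_2^2=0 ,$$ and their spherical images $$\frac{\nabla_1k_1}{k_1^2}\,\omega_{31}^2-\frac{\nabla_1k_2}{k_2^2}\,\omega_{32}^2=0\qquad\text{and}\qquad \frac{\nabla_2k_1}{k_1^2}\,\omega_{31}^2-\frac{\nabla_2k_2}{k_2^2}\,\omega_{32}^2=0 .$$ The spherical images are both orthogonal if and only if $\mathfrak{F}$ is a W-surface satisfying $$\frac1{k_1}-\frac1{k_2}=\text{const.}$$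
   Context: Setting. $\bar x(u,v)$ is a parametric representation of $\mathfrak{F}$ over a connected domain. $\{\bar e_1,\bar e_2,\bar e_3\}$ is the orthonormal moving frame with $\bar e_1,\bar e_2$ the principal directions, $\bar e_3$ the unit normal, $\det(\bar e_1,\bar e_2,\bar e_3)=1$. The linear differential forms $\omega_1,\omega_2,\omega_{ij}$ are defined by $d\bar x=\omega_1\bar e_1+\omega_2\bar e_2$, $d\bar e_i=\sum_{j}\omega_{ij}\bar e_j$ ($\omega_{ij}=-\omega_{ji}$), and $\omega_{31}=-k_1\omega_1$, $\omega_{32}=-k_2\omega_2$, where $k_1,k_2$ are the principal curvatures. For a function $f$, the Pfaffian derivatives $\nabla_1 f,\nabla_2 f$ are defined by $df=\nabla_1 f\,\omega_1+\nabla_2 f\,\omega_2$. Standing assumptions. $\mathfrak{F}$ has no parabolic points: $k_1k_2\neq 0$ everywhere. $\mathfrak{F}$ is not a canal surface, so that the central surfaces do not degenerate into curves; this is used in the form $k_1\neq k_2$, $\nabla_1k_1\neq 0$ and $\nabla_2k_2\neq0$ everywhere. Central surfaces. $\mathfrak{F}^{(i)}$, $i=1,2$, is the surface parametrized by $\bar y^{(i)}=\bar x+\frac{1}{k_i}\bar e_3$; points of $\mathfrak{F}$ and $\mathfrak{F}^{(i)}$ with the same parameters $(u,v)$ correspond to each other. The asymptotic lines of $\mathfrak{F}^{(i)}$ are the null-curves of its second fundamental form. Nets. A net on $\mathfrak{F}$ is given by a quadratic differential equation in $\omega_1,\omega_2$ (its curves may be imaginary); its spherical image is its image under the Gauss map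 $\bar e_3$ to the unit sphere, whose first fundamental form is $\omega_{31}^2+\omega_{32}^2$. A spherical net $A\,\omega_{31}^2+2B\,\omega_{31}\omega_{32}+C\,\omega_{32}^2=0$ is orthogonal if its two directions are orthogonal with respect to $\omega_{31}^2+\omega_{32}^2$, i.e. $A+C=0$ identically. A Weingarten surface (W-surface) is a surface for which there is a functional relation between $k_1$ and $k_2$. *)

(* Defs.v *)
From mathcomp Require Import all_boot all_order all_algebra.
From mathcomp Require Import all_classical all_reals all_analysis.
Import Order.TTheory GRing.Theory Num.Theory.
Import numFieldNormedType.Exports.

Set Implicit Arguments.
Unset Strict Implicit.
Unset Printing Implicit Defensive.

Local Open Scope classical_set_scope.
Local Open Scope ring_scope.

(* [f] is of class C^n on [D] (meant for open [D] and finite-dimensional [V]):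
   C^(n+1) means differentiable with every directional derivative C^n. *)
Fixpoint class_C {R : realType} {V W : normedModType R} (n : nat) (D : set V)
    (f : V -> W) : Prop :=
  if n is m.+1 then
    (forall p, D p -> differentiable f p) /\
    (forall w : V, class_C m D ('D_w f))
  else forall p, D p -> {for p, continuous f}.

Section EuclideanSpace.
Context {R : realType}.

(* The norm [`|_|] of row vectors is the sup norm, so Euclidean lengths have to
   be expressed through the inner product. *)
Definition dot (a b : 'rV[R]_3) : R := \sum_(i < 3) a 0 i * b 0 i.

Definition rows3 (a b c : 'rV[R]_3) : 'M[R]_3 :=
  \matrix_(i < 3) nth 0 [:: a; b; c] i.

Definition cross (a b : 'rV[R]_3) : 'rV[R]_3 :=
  \row_(k < 3) \det (rows3 a b (delta_mx 0 k)).

Definition pt2 (a b : R) : 'rV[R]_2 := \row_(i < 2) nth 0 [:: a; b] i.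

End EuclideanSpace.

Section Surfaces.
Context {R : realType}.

(* Parameter points (u, v) and tangent vectors of the parameter domain are both
   elements of 'rV[R]_2; a differential form is written as a function of the
   point [p] and the tangent vector [w], and the differential df(w) of a
   differentiable [f] at [p] is ['D_w f p]. *)
Implicit Types (D : set 'rV[R]_2) (p w : 'rV[R]_2).
Implicit Types (x y e : 'rV[R]_2 -> 'rV[R]_3) (k f : 'rV[R]_2 -> R).

Definition regular_surface (r : nat) D x : Prop :=
  [/\ open D, connected D, class_C r D x &
      forall p w, D p -> 'D_w x p = 0 -> w = 0].

(* Rodrigues' formula: with respect to the unit normal [n], the tangent vector
   [e p] is an eigenvector, with eigenvalue [k p], of the shape operator
   dx(w) |-> - dn(w). *)
Definition principal D x (n : 'rV[R]_2 -> 'rV[R]_3) e k : Prop :=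
  forall p, D p -> exists w, 'D_w x p = e p /\ 'D_w n p = - k p *: e p.

Record principal_frame D x e1 e2 e3 k1 k2 : Prop := PrincipalFrame {
  frame_diff1 : forall p, D p -> differentiable e1 p;
  frame_diff2 : forall p, D p -> differentiable e2 p;
  frame_diff3 : forall p, D p -> differentiable e3 p;
  frame_orthonormal : forall p, D p ->
    rows3 (e1 p) (e2 p) (e3 p) *m (rows3 (e1 p) (e2 p) (e3 p))^T = 1%:M;
  frame_oriented : forall p, D p -> \det (rows3 (e1 p) (e2 p) (e3 p)) = 1;
  frame_normal : forall p w, D p -> dot ('D_w x p) (e3 p) = 0;
  frame_principal1 : principal D x e3 e1 k1;
  frame_principal2 : principal D x e3 e2 k2
}.

(* omega x e_i is the form omega_i, and omega e_i e_j is the form omega_ij. *)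
Definition omega y e p w : R := dot ('D_w y p) (e p).

Definition pfaffian_derivatives D x e1 e2 f (f1 f2 : 'rV[R]_2 -> R) : Prop :=
  forall p w, D p -> 'D_w f p = f1 p * omega x e1 p w + f2 p * omega x e2 p w.

Definition central_surface x e3 k : 'rV[R]_2 -> 'rV[R]_3 :=
  fun p => x p + (k p)^-1 *: e3 p.

Definition unit_normal y p : 'rV[R]_3 :=
  let n := cross ('D_(delta_mx 0 0) y p) ('D_(delta_mx 0 1) y p) in
  (Num.sqrt (dot n n))^-1 *: n.

Definition second_form y p w : R :=
  dot ('D_w ('D_w y) p) (unit_normal y p).

(* The net A alpha^2 + 2 B alpha beta + C beta^2 = 0, relative to a pair of
   forms alpha, beta. *)
Record net := Net { netA : 'rV[R]_2 -> R;
                    netB : 'rV[R]_2 -> R;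
                    netC : 'rV[R]_2 -> R }.

Definition net_form (alpha beta : 'rV[R]_2 -> 'rV[R]_2 -> R) (N : net) p w : R :=
  netA N p * alpha p w ^+ 2 + 2 * netB N p * alpha p w * beta p w
  + netC N p * beta p w ^+ 2.

(* The curves of a net may be imaginary, so a net is a quadratic form up to a
   nowhere vanishing factor, and is not determined by its real directions. *)
Definition same_equation D (Q Q' : 'rV[R]_2 -> 'rV[R]_2 -> R) : Prop :=
  exists2 lambda : 'rV[R]_2 -> R,
    forall p, D p -> lambda p != 0 &
    forall p w, D p -> Q p w = lambda p * Q' p w.

(* [N] (relative to omega_1, omega_2) corresponds to the null-curves of the
   second fundamental form of [y]; points of the two surfaces correspond by
   equal parameters. *)
Definition asymptotic_net D x e1 e2 y (N : net) : Prop :=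
  same_equation D (second_form y) (net_form (omega x e1) (omega x e2) N).

(* [S] is taken relative to omega_31, omega_32, which give the components along
   e1, e2 of the image of [w] under the differential of the Gauss map [e3]. *)
Definition spherical_image D x e1 e2 e3 (N S : net) : Prop :=
  same_equation D (net_form (omega x e1) (omega x e2) N)
                  (net_form (omega e3 e1) (omega e3 e2) S).

Definition orthogonal_spherical_net D (S : net) : Prop :=
  forall p, D p -> netA S p + netC S p = 0.

(* A functional relation F(k1, k2) = 0; the differential of F must not vanish
   at the relevant points, since F = 0 would be a relation otherwise. *)
Definition Weingarten D k1 k2 : Prop :=
  exists (O : set 'rV[R]_2) (F : 'rV[R]_2 -> R^o),
    [/\ open O, class_C 1 O F &
        forall p, D p -> let q := pt2 (k1 p) (k2 p) in
          [/\ O q, F q = 0 & exists h, 'D_h F q != 0]].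

End Surfaces.
Arguments net : clear implicits.

(* Main.v *)
Require Import Defs.
From mathcomp Require Import all_boot all_order all_algebra.
From mathcomp Require Import all_classical all_reals all_analysis.
From mathcomp Require Import ring lra.
Import Order.TTheory GRing.Theory Num.Theory.
Import numFieldNormedType.Exports.
Local Open Scope classical_set_scope.
Local Open Scope ring_scope.

Set Implicit Arguments.
Unset Strict Implicit.
Unset Printing Implicit Defensive.

(* Write y = x + e3 / k1. Since de3 = - k1 omega_1 e1 - k2 omega_2 e2, one gets
   dy = (1 - k2 / k1) omega_2 e2 + d(1 / k1) e3, so the normal of y is +- e1 and
   its second form is, up to that sign, - <dy, de1>. The Codazzi equations
   (k1 - k2) omega_12 = nabla_2 k1 omega_1 + nabla_1 k2 omega_2 turn this into
   (nabla_1 k1 omega_1^2 - nabla_1 k2 omega_2^2) / k1; the other central surface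
   follows by rotating the frame to (e2, - e1, e3). Finally both spherical images
   are orthogonal iff d(1 / k1 - 1 / k2) = 0.
   The frame and the curvatures are not assumed to be smooth enough for this. The
   area density of x and then k1 - k2 are recovered from their squares, which
   are polynomial in smooth quantities, and this gives the smoothness of e3 and of
   k1, k2. *)

(** * Differentiability as a local property, and the calculus of the classes C^n on an open set *)

Lemma near_eq_differentiable {R : realType} {V W : normedModType R}
    (f g : V -> W) (p : V) :
  (\near p, f p = g p) -> differentiable f p -> differentiable g p.
Proof.
move=> fg df; have fgp : f p = g p by exact: nbhs_singleton fg.
have gE : g \o shift p = cst (g p) + 'd f p +o_ 0 id.
  apply/eqaddoP => e e0.
  have /eqaddoP/(_ e e0) := diff_locally df.
  have : \forall y \near 0, f (y + p) = g (y + p).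
    by move: fg; rewrite (near_shift 0 p) /= subr0.
  apply: filterS2 => y fgy.
  by rewrite !fctE/= fgy fgp.
apply/diff_locallyP.
have dgE : 'd g p = 'd f p :> (V -> W).
  by apply: diff_unique => //; exact: diff_continuous.
by rewrite dgE; split => //; exact: diff_continuous.
Qed.

Lemma derive_lin {R : realType} {V W : normedModType R} (f : V -> W) p a b v w :
  differentiable f p -> 'D_(a *: v + b *: w) f p = a *: 'D_v f p + b *: 'D_w f p.
Proof. by move=> df; rewrite !deriveE// linearP linearZ. Qed.

Section ClassC.
Context {R : realType} {V : normedModType R} (D : set V).
Hypothesis oD : open D.

Lemma near_open {W : Type} (f g : V -> W) p :
  (forall q, D q -> f q = g q) -> D p -> \near p, f p = g p.
Proof. by move=> fg Dp; apply: filterS (open_nbhs_nbhs (conj oD Dp)). Qed.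

Lemma open_differentiable {W : normedModType R} (f g : V -> W) p :
  (forall q, D q -> f q = g q) -> D p -> differentiable f p -> differentiable g p.
Proof. by move=> fg Dp; apply: near_eq_differentiable; exact: near_open. Qed.

Lemma open_derive {W : normedModType R} (f g : V -> W) p w :
  (forall q, D q -> f q = g q) -> D p -> 'D_w f p = 'D_w g p.
Proof. by move=> fg Dp; apply: near_eq_derive; exact: near_open. Qed.

(** Since [D] is open, equality on [D] is equality near each of its points, so all derivatives agree
    on [D] as well. This is what lets formulas valid only on [D] transfer smoothness. *)
Lemma class_C_ext {W : normedModType R} n (f g : V -> W) :
  (forall p, D p -> f p = g p) -> class_C n D f -> class_C n D g.
Proof.
elim: n f g => [|n IH] f g fg.
  move=> cf p Dp; have nfg := near_open fg Dp.
  change (g @ p --> g p); rewrite -(fg p Dp); apply: cvg_trans (cf p Dp).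
  by apply: near_eq_cvg.
move=> [df dwf]; split=> [p Dp|w].
  by apply: open_differentiable fg Dp (df p Dp).
by apply: IH (dwf w) => p Dp; apply: open_derive.
Qed.

Lemma class_C_differentiable {W : normedModType R} n (f : V -> W) p :
  class_C n.+1 D f -> D p -> differentiable f p.
Proof. by case=> df _; exact: df. Qed.

Lemma class_CW {W : normedModType R} n (f : V -> W) :
  class_C n.+1 D f -> class_C n D f.
Proof.
elim: n f => [|n IH] f [df dwf].
  by move=> p Dp; apply/differentiable_continuous/df.
by split=> // w; apply/IH/dwf.
Qed.

Lemma class_C_leq {W : normedModType R} m n (f : V -> W) :
  (m <= n)%N -> class_C n D f -> class_C m D f.
Proof.
by move=> /subnK <-; elim: (n - m)%N => // k IH; rewrite addSn => /class_CW.
Qed.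

Lemma class_C_cst {W : normedModType R} n (a : W) : class_C n D (cst a).
Proof.
elim: n a => [|n IH] a; first by move=> p _; exact: cst_continuous.
split=> [p _|w]; first exact: differentiable_cst.
by apply: class_C_ext (IH 0) => p _; rewrite derive_cst.
Qed.

Lemma class_CD {W : normedModType R} n (f g : V -> W) :
  class_C n D f -> class_C n D g -> class_C n D (f + g).
Proof.
elim: n f g => [|n IH] f g.
  by move=> cf cg p Dp; apply: continuousD; [exact: cf|exact: cg].
move=> [df dwf] [dg dwg]; split=> [p Dp|w].
  by apply: differentiableD; [exact: df|exact: dg].
apply: class_C_ext (IH _ _ (dwf w) (dwg w)) => p Dp.
by rewrite deriveD//; apply: diff_derivable; [exact: df|exact: dg].
Qed.

Lemma class_CZl {W : normedModType R} n (k : V -> R) (a : W) :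
  class_C n D k -> class_C n D (fun p => k p *: a).
Proof.
elim: n k => [|n IH] k.
  by move=> ck p Dp; apply: continuousZr_tmp; exact: ck.
move=> [dk dwk]; split=> [p Dp|w]; first exact/differentiableZl/dk.
apply: class_C_ext (IH _ (dwk w)) => p Dp.
by rewrite deriveE ?(deriveE _ (differentiableZl _ _)) ?diffZl//; exact/dk.
Qed.

Lemma class_CM n (f g : V -> R) :
  class_C n D f -> class_C n D g -> class_C n D (f * g).
Proof.
elim: n f g => [|n IH] f g.
  by move=> cf cg p Dp; apply: continuousM; [exact: cf|exact: cg].
move=> cf cg; have [[df dwf] [dg dwg]] := (cf, cg); split=> [p Dp|w].
  by apply: differentiableM; [exact: df|exact: dg].
have := class_CD (IH _ _ (class_CW cf) (dwg w)) (IH _ _ (class_CW cg) (dwf w)).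
apply: class_C_ext => p Dp.
by rewrite deriveM//; apply: diff_derivable; [exact: df|exact: dg].
Qed.

Lemma class_CN n (f : V -> R) : class_C n D f -> class_C n D (- f).
Proof.
move=> cf; apply: class_C_ext (class_CM (class_C_cst n (-1 : R)) cf) => p _.
by rewrite !fctE mulN1r.
Qed.

Lemma class_CB n (f g : V -> R) :
  class_C n D f -> class_C n D g -> class_C n D (f - g).
Proof. by move=> cf cg; apply: class_CD => //; exact: class_CN. Qed.

Lemma class_CV n (f : V -> R) : (forall p, D p -> f p != 0) ->
  class_C n D f -> class_C n D (fun p => (f p)^-1).
Proof.
move=> f0; elim: n => [|n IH] cf.
  by move=> p Dp; apply: continuousV; [exact: f0|exact: cf].
have [df dwf] := cf; split=> [p Dp|w].
  by apply: differentiableV; [exact: df|exact: f0].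
have cV := IH (class_CW cf).
apply: class_C_ext (class_CN (class_CM (class_CM cV cV) (dwf w))) => p Dp.
rewrite deriveV ?f0//; last exact/diff_derivable/df.
by rewrite !fctE scaleNr /GRing.scale/= expr2 invfM.
Qed.

(* As f does not vanish, df = d(f * f) / (2 f), whatever the sign of f. *)
Lemma class_C_sqrt n (f : V -> R) :
  (forall p, D p -> differentiable f p) -> (forall p, D p -> f p != 0) ->
  class_C n D (f * f) -> class_C n D f.
Proof.
move=> df f0; elim: n => [|n IH] cff.
  by move=> p Dp; apply/differentiable_continuous/df.
have cf := IH (class_CW cff); split=> // w.
have c2 := class_CM (class_C_cst n (2^-1 : R)) (class_CV f0 cf).
have [_ /(_ w) dff] := cff.
apply: class_C_ext (class_CM c2 dff) => p Dp.
have dfp : derivable f p w by exact/diff_derivable/df.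
rewrite !fctE deriveM// /GRing.scale/= /cst; have := f0 _ Dp; set a := f p.
by move=> a0; field.
Qed.

End ClassC.

(** * Vector-valued functions, treated coordinate by coordinate *)

Section RowVectors.
Context {R : realType} {V : normedModType R} {m : nat}.
Implicit Types f g : V -> 'rV[R]_m.

Lemma differentiable_row_coord f p i :
  differentiable f p -> differentiable (fun q => f q 0 i) p.
Proof.
move=> df; apply: (@differentiable_comp _ _ _ _ f (fun M : 'rV[R]_m => M 0 i)) => //.
exact: differentiable_coord.
Qed.

Lemma derive_row_coord f p w i :
  derivable f p w -> 'D_w f p 0 i = 'D_w (fun q => f q 0 i) p.
Proof. by move=> df; rewrite derive_mx// mxE. Qed.

Lemma derivable_row_coord f p w i :
  derivable f p w -> derivable (fun q => f q 0 i) p w.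
Proof. by move/derivable_mxP; exact. Qed.

Lemma class_C_row_coord (D : set V) n f i : open D ->
  class_C n D f -> class_C n D (fun q => f q 0 i).
Proof.
move=> oD; elim: n f => [|n IH] f.
  - move=> cf p Dp; apply: (@continuous_comp _ _ _ f (fun M : 'rV[R]_m => M 0 i)).
      exact: cf.
    exact: coord_continuous.
- move=> [df dwf]; split=> [p Dp|w]; first exact/differentiable_row_coord/df.
apply: class_C_ext (IH _ (dwf w)) => // p Dp.
by rewrite derive_row_coord//; exact/diff_derivable/df.
Qed.

Lemma class_C_rowP (D : set V) n f : open D ->
  (forall i, class_C n D (fun q => f q 0 i)) -> class_C n D f.
Proof.
move=> oD cf; have -> : f = \sum_i (fun q => f q 0 i *: delta_mx 0 i).
  by rewrite funeqE => q; rewrite fct_sumE [LHS]row_sum_delta.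
elim/big_ind : _ => [|? ? ? ?|i _]; first exact: class_C_cst.
- exact: class_CD.
- exact/class_CZl.
Qed.

Lemma is_derive_scale (k : V -> R) f p w :
  derivable k p w -> derivable f p w ->
  is_derive p w (fun q => k q *: f q) ('D_w k p *: f p + k p *: 'D_w f p).
Proof.
move=> dk df.
have dkf i : is_derive p w (fun q => (k q *: f q) 0 i)
    (('D_w k p *: f p + k p *: 'D_w f p) 0 i).
  have -> : (fun q => (k q *: f q) 0 i) = k * (fun q => f q 0 i).
    by rewrite funeqE => q; rewrite mxE.
  have dfi := derivable_row_coord (i := i) df.
  apply: is_derive_eq (is_deriveM (derivableP dk) (derivableP dfi)) _.
  rewrite !mxE derive_row_coord// addrC.
  by congr (_ + _); rewrite /GRing.scale/= mulrC.
have d : derivable (fun q => k q *: f q) p w.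
  by apply/derivable_mxP => i j; rewrite ord1; case: (dkf j).
apply: DeriveDef => //; apply/rowP => i.
by rewrite derive_row_coord//; case: (dkf i).
Qed.

End RowVectors.

(** * Mean value theorem along segments, and constancy on connected open sets *)

Section LineRestriction.
Context {R : realType} {V : normedModType R}.
Implicit Types f : V -> R.

Lemma is_derive_line f (p v : V) (t : R) :
  differentiable f (p + t *: v) ->
  is_derive t 1 (fun s => f (p + s *: v)) ('D_v f (p + t *: v)).
Proof.
move=> df.
have e1 : (fun h : R => h^-1 *: (((fun s : R => f (p + s *: v)) \o shift t) (h *: 1) - f (p + t *: v)))
  = (fun h => h^-1 *: ((f \o shift (p + t *: v)) (h *: v) - f (p + t *: v))).
  rewrite funeqE => h /=; congr (_ *: (f _ - _)).
  by rewrite [h *: 1]mulr1 scalerDl addrCA.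
by split; rewrite ?/derivable ?/derive e1//; exact: diff_derivable.
Qed.

Lemma mean_value_line f (p v : V) (h : R) : 0 < h ->
  (forall t, 0 <= t <= h -> differentiable f (p + t *: v)) ->
  exists2 c, 0 < c < h & f (p + h *: v) - f p = h * 'D_v f (p + c *: v).
Proof.
move=> h0 df.
have d t : t \in `[0, h] -> is_derive t 1 (fun s => f (p + s *: v)) ('D_v f (p + t *: v)).
  by move=> th; apply/is_derive_line/df; move: th; rewrite in_itv.
have doo t : t \in `]0, h[ -> is_derive t 1 (fun s => f (p + s *: v)) ('D_v f (p + t *: v)).
  by move=> th; apply: d; apply: subset_itv_oo_cc th.
have cc : {within `[0, h], continuous (fun s => f (p + s *: v))}.
  by apply: derivable_within_continuous => t /d [].
have [c ch] := MVT h0 doo cc.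
rewrite scale0r addr0 subr0 => ->; exists c; last by rewrite mulrC.
by move: ch; rewrite in_itv.
Qed.

End LineRestriction.

Section Constancy.
Context {R : realType} {V : normedModType R}.

(** The mean value theorem along radii of a ball inside [D] makes [f] locally constant. Level sets
    are then open and closed in [D], and connectedness concludes. *)
Lemma derive0_constant (D : set V) (f : V -> R) : open D -> connected D ->
  (forall p, D p -> differentiable f p) ->
  (forall p w, D p -> 'D_w f p = 0) ->
  forall p q, D p -> D q -> f p = f q.
Proof.
move=> oD cD df df0.
have ball_cst p : D p -> \forall q \near p, D q /\ f q = f p.
  move=> Dp; have /nbhs_ballP[e /= e0 De] : nbhs p D by exact: open_nbhs_nbhs.
  apply/nbhs_ballP; exists e => //= q pq; split; first exact: De.
  have Dl t : 0 <= t <= 1 -> D (p + t *: (q - p)).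
    move=> /andP[t0 t1]; apply: De; move: pq; rewrite -ball_normE /=.
    rewrite opprD addrA subrr add0r normrN normrZ ger0_norm// distrC.
    by apply: le_lt_trans; rewrite ler_piMl.
  have dl t : 0 <= t <= 1 -> differentiable f (p + t *: (q - p)).
    by move=> /Dl; exact: df.
  have [c /andP[c0 c1]] := mean_value_line ltr01 dl.
  rewrite scale1r subrKC df0 ?mulr0; last by apply: Dl; rewrite (ltW c0) (ltW c1).
  by move/eqP; rewrite subr_eq0 => /eqP.
move=> p q Dp Dq; pose B := D `&` [set r | f r = f p].
have oB : open B.
  rewrite openE => r [Dr fr]; have := ball_cst _ Dr.
  by apply: filterS => s [Ds fs]; split => //=; rewrite fs.
have oC : open (D `\` B).
  rewrite openE => r [Dr nBr]; have := ball_cst _ Dr.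
  apply: filterS => s [Ds fs]; split => // -[_ /= fsp]; apply: nBr.
  by split=> //=; rewrite -fs.
(* The level set [B] of [f] through [p] is open, and its complement in [D] is open too, so [B] is
   relatively clopen and nonempty. *)
suff BD : B = D by have [] : B q by rewrite BD.
apply: cD; first by exists p.
- by exists B => //; rewrite setIA setIid.
- exists (~` (D `\` B)); first exact: open_closedC.
  rewrite setCD setIUr setICr set0U; apply/seteqP; split=> r; last by case.
  by move=> [].
Qed.

End Constancy.

(** * Symmetry of second derivatives *)

Section Schwarz.
Context {R : realType} {V : normedModType R}.
Implicit Types f : V -> R.

Lemma differentiable_shift f (a p w : V) : differentiable f (p + a) ->
  differentiable (fun q => f (q + a)) p /\
  'D_w (fun q => f (q + a)) p = 'D_w f (p + a).
Proof.
move=> df; split.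
  have da : differentiable (id + cst a : V -> V) p.
    by apply: differentiableD => //; exact: differentiable_cst.
  exact: (@differentiable_comp _ _ _ _ (id + cst a) f p da df).
rewrite /derive; set g1 := fun h => _; set g2 := fun h => _.
suff -> : g1 = g2 by [].
by rewrite funeqE /g1 /g2 => h /=; rewrite addrA.
Qed.

(** Two applications of the mean value theorem, first along [w] and then along [v], turn the second
    difference into [h * h] times a value of ['D_v ('D_w f)] at a point of the parallelogram;
    continuity at [p] then gives the estimate. *)
Lemma second_difference (D : set V) f (p v w : V) (eps : R) :
  open D -> class_C 2 D f -> D p -> 0 < eps ->
  exists2 d, 0 < d & forall h, 0 < h < d -> exists2 a,
    f (p + h *: w + h *: v) - f (p + h *: w) - f (p + h *: v) + f p
    = h * h * a & `|a - 'D_v ('D_w f) p| < eps.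
Proof.
move=> oD [df dwf] Dp eps0.
have [d'f /(_ v) c2] := dwf w.
have nD : \forall q \near p, D q by exact: open_nbhs_nbhs.
have /cvgrPdist_lt/(_ eps eps0) nc := c2 p Dp.
have nDc : nbhs p [set q | D q /\ `|'D_v ('D_w f) p - 'D_v ('D_w f) q| < eps].
  exact: filterI nD nc.
have /nbhs_ballP[r /= r0 Hr] := nDc.
have M0 : 0 < `|v| + `|w| + 1 by rewrite ltr_wpDl// addr_ge0.
(* This bound on [h] keeps the parallelogram inside the ball of radius [r]; the summand 1 makes the
   denominator positive even when [v] and [w] both vanish. *)
exists (r / (`|v| + `|w| + 1)); first exact: divr_gt0.
move=> h /andP[h0]; rewrite ltr_pdivlMr// => hr.
have box s t : 0 <= s <= h -> 0 <= t <= h -> ball p r (p + s *: w + t *: v).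
  move=> /andP[s0 sh] /andP[t0 th]; rewrite -ball_normE /=.
  rewrite -addrA opprD addrA subrr add0r normrN.
  apply: le_lt_trans (ler_normD _ _) _; rewrite !normrZ !ger0_norm//.
  apply: le_lt_trans hr; have := normr_ge0 v; have := normr_ge0 w.
  by move: `|w| `|v| => a b a0 b0; nra.
have hh : 0 <= h <= h by rewrite lexx ltW.
have z0 : (0 : R) <= 0 <= h by apply/andP; split => //; exact: ltW.
have box0 s : 0 <= s <= h -> ball p r (p + s *: w).
  by move=> sh; have := box s 0 sh z0; rewrite scale0r addr0.
(* The second difference is the increment of [g] from [p] to [p + h *: w]. *)
pose g q := f (q + h *: v) - f q.
have dg s : 0 <= s <= h -> differentiable g (p + s *: w).
  move=> sh; apply: (@differentiableB _ _ _ (fun q => f (q + h *: v)) f).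
    by have [] := @differentiable_shift f (h *: v) (p + s *: w) w (df _ (Hr _ (box _ _ sh hh)).1).
  exact: (df _ (Hr _ (box0 _ sh)).1).
have [c /andP[c0 ch] gE] := mean_value_line h0 dg.
have {c0 ch} ch : 0 <= c <= h by rewrite !ltW.
have dg' : 'D_w g (p + c *: w) = 'D_w f (p + c *: w + h *: v) - 'D_w f (p + c *: w).
  have [d1 d2] := @differentiable_shift f (h *: v) (p + c *: w) w (df _ (Hr _ (box _ _ ch hh)).1).
  rewrite -d2 -deriveB//; first exact: diff_derivable.
  exact/diff_derivable/df/(Hr _ (box0 _ ch)).1.
have d2 t : 0 <= t <= h -> differentiable ('D_w f) (p + c *: w + t *: v).
  by move=> th; exact: (d'f _ (Hr _ (box _ _ ch th)).1).
have [c' /andP[c'0 c'h] E] := mean_value_line h0 d2.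
exists ('D_v ('D_w f) (p + c *: w + c' *: v)).
  by rewrite -mulrA -E -dg' -gE /g; ring.
have c'P : 0 <= c' <= h by rewrite !ltW.
by rewrite distrC; exact: (Hr _ (box _ _ ch c'P)).2.
Qed.

(** The second difference is symmetric in [v] and [w], so one and the same quotient by [h * h] is
    arbitrarily close to both mixed derivatives. *)
Lemma derive_comm (D : set V) f (p v w : V) :
  open D -> class_C 2 D f -> D p -> 'D_v ('D_w f) p = 'D_w ('D_v f) p.
Proof.
move=> oD cf Dp; apply/eqP; rewrite -subr_eq0 -normr_le0.
apply/ler_addgt0Pr => e e0; rewrite add0r.
have e2 : 0 < e / 2 by rewrite divr_gt0.
have [d1 d10 H1] := second_difference v w oD cf Dp e2.
have [d2 d20 H2] := second_difference w v oD cf Dp e2.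
pose h := Num.min d1 d2 / 2.
have m0 : 0 < Num.min d1 d2 by rewrite lt_min d10.
have h0 : 0 < h by rewrite divr_gt0.
have : h < Num.min d1 d2 by rewrite /h; lra.
rewrite lt_min => /andP[h1 h2].
have [|a Ea Ha] := H1 h; first by rewrite h0.
have [|b Eb Hb] := H2 h; first by rewrite h0.
have ab : a = b.
  have /mulfI : h * h != 0 by rewrite mulf_neq0// gt_eqF.
  apply; rewrite -Ea -Eb (addrAC p); ring.
move: Ha Hb; rewrite {}ab.
move: ('D_v ('D_w f) p) ('D_w ('D_v f) p) => l1 l2 Ha Hb.
rewrite -(subrKA b) (le_trans (ler_normD _ _))// [e]splitr.
by rewrite lerD ?ltW// distrC.
Qed.

End Schwarz.

(** * Inner product, cross product and oriented orthonormal frames in space *)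

Section Space.
Context {R : realType}.
Implicit Types a b c d : 'rV[R]_3.

Lemma derive_row_comm {V : normedModType R} {m} (D : set V) (f : V -> 'rV[R]_m) p v w :
  open D -> class_C 2 D f -> D p -> 'D_v ('D_w f) p = 'D_w ('D_v f) p.
Proof.
move=> oD cf Dp; have [df dwf] := cf.
have coordE u u' i : 'D_u ('D_u' f) p 0 i = 'D_u ('D_u' (fun q => f q 0 i)) p.
  rewrite derive_row_coord; last by apply/diff_derivable; have [+ _] := dwf u'; exact.
  apply: (open_derive oD) => // q Dq.
  by rewrite derive_row_coord//; exact/diff_derivable/df.
apply/rowP => i.
have cfi := class_C_row_coord i oD cf.
have E := derive_comm v w oD cfi Dp.
apply: (etrans (coordE v w i)).
exact: (etrans E (esym (coordE w v i))).
Qed.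

Lemma sum3 (F : 'I_3 -> R) : \sum_i F i = F 0 + F 1 + F 2.
Proof.
rewrite !big_ord_recl big_ord0 addr0 addrA.
by congr (F _ + F _ + F _); apply: val_inj.
Qed.

Lemma dotE a b : dot a b = a 0 0 * b 0 0 + a 0 1 * b 0 1 + a 0 2 * b 0 2.
Proof. exact: sum3. Qed.

Lemma det3 (M : 'M[R]_3) : \det M =
  M 0 0 * (M 1 1 * M 2 2 - M 1 2 * M 2 1) + M 0 1 * (M 1 2 * M 2 0 - M 1 0 * M 2 2)
  + M 0 2 * (M 1 0 * M 2 1 - M 1 1 * M 2 0).
Proof.
(* Passing to natural-number indices identifies the different ordinal terms for the same entry that
   the cofactor expansion produces. *)
pose f (i j : nat) := M (inord i) (inord j).
have Mf i j : M i j = f i j by rewrite /f !inord_val.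
rewrite (expand_det_row _ ord0) !big_ord_recl big_ord0 /cofactor.
rewrite !(expand_det_row _ ord0) !big_ord_recl !big_ord0 /cofactor !det_mx11 !mxE !Mf /=.
rewrite /bump /=; ring.
Qed.

Lemma crossE a b : cross a b =
  \row_k nth 0 [:: a 0 1 * b 0 2 - a 0 2 * b 0 1; a 0 2 * b 0 0 - a 0 0 * b 0 2;
                   a 0 0 * b 0 1 - a 0 1 * b 0 0] k.
Proof.
apply/rowP => k; rewrite !mxE det3 !mxE /= -!val_eqE /=.
by case: k => -[|[|[|//]]] ? /=; rewrite ?mulr1n ?mulr0n; ring.
Qed.

Lemma rows3_gram a b c (i j : 'I_3) : (rows3 a b c *m (rows3 a b c)^T) i j
  = dot (nth 0 [:: a; b; c] i) (nth 0 [:: a; b; c] j).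
Proof. by rewrite mxE; apply: eq_bigr => k _; rewrite !mxE. Qed.

Lemma dotC a b : dot a b = dot b a.
Proof. by rewrite !dotE; ring. Qed.

Lemma dotDl a b c : dot (a + b) c = dot a c + dot b c.
Proof. by rewrite !dotE !mxE; ring. Qed.

Lemma dotZl k a b : dot (k *: a) b = k * dot a b.
Proof. by rewrite !dotE !mxE; ring. Qed.

Lemma dotZr k a b : dot a (k *: b) = k * dot a b.
Proof. by rewrite !dotE !mxE; ring. Qed.

Lemma dotNl a b : dot (- a) b = - dot a b.
Proof. by rewrite !dotE !mxE; ring. Qed.

Lemma dotNr a b : dot a (- b) = - dot a b.
Proof. by rewrite dotC dotNl dotC. Qed.

Lemma dot_comb (k l : R) a b c : dot (k *: a + l *: b) c = k * dot a c + l * dot b c.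
Proof. by rewrite dotDl !dotZl. Qed.

Lemma cross_comb (u v : 'rV[R]_3) (k l m n : R) :
  cross (k *: u + l *: v) (m *: u + n *: v) = (k * n - l * m) *: cross u v.
Proof.
by rewrite !crossE; apply/rowP => i; rewrite !mxE; case: i => -[|[|[|//]]] ? /=; ring.
Qed.

Lemma class_C_dot {V : normedModType R} (D : set V) n (f g : V -> 'rV[R]_3) :
  open D -> class_C n D f -> class_C n D g -> class_C n D (fun p => dot (f p) (g p)).
Proof.
move=> oD cf cg; have c i := class_CM oD (class_C_row_coord i oD cf) (class_C_row_coord i oD cg).
apply: class_C_ext (class_CD oD (class_CD oD (c 0) (c 1)) (c 2)) => // p _.
by rewrite dotE.
Qed.

Lemma class_C_cross {V : normedModType R} (D : set V) n (f g : V -> 'rV[R]_3) :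
  open D -> class_C n D f -> class_C n D g -> class_C n D (fun p => cross (f p) (g p)).
Proof.
move=> oD cf cg; apply: class_C_rowP => // k.
have c i j := class_CM oD (class_C_row_coord i oD cf) (class_C_row_coord j oD cg).
have d i j := class_CB oD (c i j) (c j i).
case: k => -[|[|[|//]]] kp.
- by apply: class_C_ext (d 1 2) => // p _; rewrite crossE mxE.
- by apply: class_C_ext (d 2 0) => // p _; rewrite crossE mxE.
- by apply: class_C_ext (d 0 1) => // p _; rewrite crossE mxE.
Qed.

Lemma is_derive_dot {V : normedModType R} (f g : V -> 'rV[R]_3) p w :
  derivable f p w -> derivable g p w ->
  is_derive p w (fun q => dot (f q) (g q)) (dot ('D_w f p) (g p) + dot (f p) ('D_w g p)).
Proof.
move=> df dg.
have d i := is_deriveM (derivableP (derivable_row_coord (i := i) df))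
                       (derivableP (derivable_row_coord (i := i) dg)).
have := is_deriveD (is_deriveD (d 0) (d 1)) (d 2).
set F := (X in is_derive _ _ X _).
have -> : F = fun q => dot (f q) (g q) by rewrite funeqE => q; rewrite dotE.
move=> dF; apply: is_derive_eq dF _.
have c i := (derive_row_coord i df, derive_row_coord i dg).
rewrite !dotE !c /GRing.scale/=; ring.
Qed.

Section Frame.
Variables e1 e2 e3 : 'rV[R]_3.
Hypothesis on : rows3 e1 e2 e3 *m (rows3 e1 e2 e3)^T = 1%:M.

Lemma frame_dot : [/\ dot e1 e1 = 1, dot e2 e2 = 1, dot e3 e3 = 1 &
  [/\ dot e1 e2 = 0, dot e1 e3 = 0 & dot e2 e3 = 0]].
Proof.
have H (i j : 'I_3) : dot (nth 0 [:: e1; e2; e3] i) (nth 0 [:: e1; e2; e3] j) = (i == j :> 'I_3)%:R.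
  by rewrite -rows3_gram on mxE.
split; [exact: (H 0 0)|exact: (H 1 1)|exact: (H 2 2)|].
by split; [exact: (H 0 1)|exact: (H 0 2)|exact: (H 1 2)].
Qed.

Lemma frame_expand a : a = dot a e1 *: e1 + dot a e2 *: e2 + dot a e3 *: e3.
Proof.
(* A one-sided inverse of a square matrix is two-sided: the transpose times the frame matrix is also
   the identity, and multiplying [a] by this product gives the expansion. *)
have /mulmx1C on' := on.
rewrite -[LHS]mulmx1 -on' mulmxA; apply/rowP => k.
by rewrite !mxE sum3 !mxE /dot; congr (_ * _ + _ * _ + _ * _);
  apply: eq_bigr => i _; rewrite !mxE.
Qed.

Hypothesis or : \det (rows3 e1 e2 e3) = 1.

(** The components of the cross product along the frame are determinants: the one along [e1] is the
    orientation determinant, the other two have a repeated row. *)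
Lemma frame_cross23 : cross e2 e3 = e1.
Proof.
rewrite [LHS]frame_expand.
have -> : dot (cross e2 e3) e1 = 1.
  by rewrite -or det3 crossE dotE !mxE /=; ring.
have -> : dot (cross e2 e3) e2 = 0 by rewrite crossE dotE !mxE /=; ring.
have -> : dot (cross e2 e3) e3 = 0 by rewrite crossE dotE !mxE /=; ring.
by rewrite !scale0r !addr0 scale1r.
Qed.

Lemma frame_cross12 : cross e1 e2 = e3.
Proof.
rewrite [LHS]frame_expand.
have -> : dot (cross e1 e2) e3 = 1.
  by rewrite -or det3 crossE dotE !mxE /=; ring.
have -> : dot (cross e1 e2) e2 = 0 by rewrite crossE dotE !mxE /=; ring.
have -> : dot (cross e1 e2) e1 = 0 by rewrite crossE dotE !mxE /=; ring.
by rewrite !scale0r !add0r scale1r.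
Qed.

End Frame.

End Space.

(** * Regularity of scaled vector fields and inner products; derivatives in coordinates of the
    plane *)

Section VectorCalculus.
Context {R : realType} {V : normedModType R} (D : set V).

Lemma class_C_scale n {m} (k : V -> R) (f : V -> 'rV[R]_m) : open D ->
  class_C n D k -> class_C n D f -> class_C n D (fun p => k p *: f p).
Proof.
move=> oD ck cf; apply: class_C_rowP => // i.
have := class_CM oD ck (class_C_row_coord i oD cf).
by apply: class_C_ext => // p _; rewrite mxE.
Qed.

Lemma differentiable_dot (f g : V -> 'rV[R]_3) p :
  differentiable f p -> differentiable g p ->
  differentiable (fun q => dot (f q) (g q)) p.
Proof.
move=> df dg; have d i := differentiableM (differentiable_row_coord i df)
  (differentiable_row_coord i dg).
have := differentiableD (differentiableD (d 0) (d 1)) (d 2).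
set F := (X in differentiable X _ -> _) => dF.
have FE : F = fun q => dot (f q) (g q) by rewrite funeqE => q; rewrite dotE.
by rewrite -FE.
Qed.

End VectorCalculus.

Lemma derive_rV2 {R : realType} {m} (f : 'rV[R]_2 -> 'rV[R]_m) p w :
  differentiable f p ->
  'D_w f p = w 0 0 *: 'D_(delta_mx 0 0) f p + w 0 1 *: 'D_(delta_mx 0 1) f p.
Proof.
move=> df; have <- := derive_lin (w 0 0) (w 0 1) (delta_mx 0 0) (delta_mx 0 1) df.
congr ('D_ _ f p).
rewrite [LHS]row_sum_delta !big_ord_recl big_ord0 addr0.
by have -> : lift ord0 ord0 = 1 :> 'I_2 by exact: val_inj.
Qed.

(** * Structure equations of the surface, and smoothness of its normal and curvatures *)

Section Surface.
Context {R : realType} (D : set 'rV[R]_2) (x e1 e2 e3 : 'rV[R]_2 -> 'rV[R]_3).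
Context (k1 k2 : 'rV[R]_2 -> R).
Hypothesis oD : open D.
Hypothesis xC : class_C 4 D x.
Hypothesis xreg : forall p w, D p -> 'D_w x p = 0 -> w = 0.
Hypothesis frame : principal_frame D x e1 e2 e3 k1 k2.
Hypothesis nonumbilic : forall p, D p -> k1 p != k2 p.

Local Notation u := (delta_mx 0 0 : 'rV[R]_2).
Local Notation v := (delta_mx 0 1 : 'rV[R]_2).
Local Notation o1 := (omega x e1).
Local Notation o2 := (omega x e2).

Lemma surface_differentiable p : D p -> differentiable x p.
Proof. exact: class_C_differentiable xC. Qed.

Lemma derive_surface p w : D p -> 'D_w x p = o1 p w *: e1 p + o2 p w *: e2 p.
Proof.
move=> Dp; rewrite [LHS](frame_expand (frame_orthonormal frame Dp)).
by rewrite (frame_normal frame)// scale0r addr0.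
Qed.

(** The vectors supplied by Rodrigues' formula for the two principal directions form the basis dual
    to [omega_1, omega_2]: [w] and its expansion have the same image under [dx], which is injective
    by regularity. *)
Lemma dual_vectors p : D p -> exists w1 w2,
  [/\ 'D_w1 x p = e1 p, 'D_w2 x p = e2 p,
      'D_w1 e3 p = - k1 p *: e1 p, 'D_w2 e3 p = - k2 p *: e2 p &
      forall w, w = o1 p w *: w1 + o2 p w *: w2].
Proof.
move=> Dp; have [w1 [x1 n1]] := frame_principal1 frame Dp.
have [w2 [x2 n2]] := frame_principal2 frame Dp.
exists w1, w2; split=> // w; have dx := surface_differentiable Dp.
apply/subr0_eq/(xreg Dp); rewrite -scaleN1r -[X in X + _]scale1r.
by rewrite !derive_lin// x1 x2 -derive_surface// scale1r scaleN1r subrr.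
Qed.

Lemma dual_basis p : D p -> exists w1 w2,
  [/\ o1 p w1 = 1, o2 p w1 = 0, o1 p w2 = 0, o2 p w2 = 1 &
      forall w, w = o1 p w *: w1 + o2 p w *: w2].
Proof.
move=> Dp; have [w1 [w2 [x1 x2 _ _ wE]]] := dual_vectors Dp.
have [d11 d22 d33 [d12 d13 d23]] := frame_dot (frame_orthonormal frame Dp).
by exists w1, w2; split; rewrite 1?/omega ?x1 ?x2// 1?dotC.
Qed.

Lemma derive_normal p w : D p ->
  'D_w e3 p = - (k1 p * o1 p w) *: e1 p + - (k2 p * o2 p w) *: e2 p.
Proof.
move=> Dp; have [w1 [w2 [_ _ n1 n2 wE]]] := dual_vectors Dp.
rewrite [in LHS](wE w) (derive_lin _ _ _ _ (frame_diff3 frame Dp)) n1 n2 !scalerA.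
by rewrite !mulrN !(mulrC (omega _ _ _ _)).
Qed.

Lemma omega_coord e p w : D p ->
  omega x e p w = w 0 0 * omega x e p u + w 0 1 * omega x e p v.
Proof.
move=> Dp; have dx := derive_rV2 w (surface_differentiable Dp).
exact: (etrans (congr1 (fun a => dot a (e p)) dx) (dot_comb _ _ _ _ _)).
Qed.

(* omega_1 /\ omega_2 evaluated on the coordinate vectors (u, v) *)
Definition jac p := o1 p u * o2 p v - o2 p u * o1 p v.

Lemma jac_neq0 p : D p -> jac p != 0.
Proof.
move=> Dp; apply/eqP.
have [w1 [w2 [+ + + + _]]] := dual_basis Dp.
rewrite (omega_coord e1 w1 Dp) (omega_coord e2 w1 Dp).
rewrite (omega_coord e1 w2 Dp) (omega_coord e2 w2 Dp) /jac.
generalize (o1 p u) (o1 p v) (o2 p u) (o2 p v) => a b c d A B C E j0.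
(* Multiplicativity of 2 x 2 determinants: the determinant of the dual basis times [jac p] is the
   determinant of the identity, so [jac p = 0] would give 0 = 1. *)
have : (w1 0 0 * w2 0 1 - w1 0 1 * w2 0 0) * (a * d - c * b)
    = (w1 0 0 * a + w1 0 1 * b) * (w2 0 0 * c + w2 0 1 * d)
      - (w1 0 0 * c + w1 0 1 * d) * (w2 0 0 * a + w2 0 1 * b) by ring.
by rewrite A B C E j0 !mulr0 mulr1 subr0 => /eqP; rewrite eq_sym oner_eq0.
Qed.

Lemma cross_tangent p a b c d : D p ->
  cross (a *: e1 p + b *: e2 p) (c *: e1 p + d *: e2 p) = (a * d - b * c) *: e3 p.
Proof.
move=> Dp; rewrite cross_comb.
by rewrite (frame_cross12 (frame_orthonormal frame Dp) (frame_oriented frame Dp)).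
Qed.

Lemma cross_derive_surface p : D p -> cross ('D_u x p) ('D_v x p) = jac p *: e3 p.
Proof.
move=> Dp.
apply: (etrans (congr2 cross (derive_surface u Dp) (derive_surface v Dp))).
exact: cross_tangent.
Qed.

(** The determinant of the shape operator appears as the ratio of area densities of [e3] and [x].
    With the mixed product below, which yields the trace, it expresses the symmetric functions of
    [k1, k2] without [e1] and [e2]. *)
Lemma cross_derive_normal p : D p ->
  cross ('D_u e3 p) ('D_v e3 p) = (k1 p * k2 p * jac p) *: e3 p.
Proof.
move=> Dp.
apply: (etrans (congr2 cross (derive_normal u Dp) (derive_normal v Dp))).
apply: (etrans (cross_tangent _ _ _ _ Dp)); congr (_ *: _); rewrite /jac.
by generalize (o1 p u) (o1 p v) (o2 p u) (o2 p v) => a b c d; ring.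
Qed.

Lemma cross_derive_mixed p : D p ->
  cross ('D_u e3 p) ('D_v x p) + cross ('D_u x p) ('D_v e3 p)
  = - ((k1 p + k2 p) * jac p) *: e3 p.
Proof.
move=> Dp.
apply: (etrans (congr2 +%R
  (congr2 cross (derive_normal u Dp) (derive_surface v Dp))
  (congr2 cross (derive_surface u Dp) (derive_normal v Dp)))).
rewrite !cross_tangent// -scalerDl; congr (_ *: _); rewrite /jac.
by generalize (o1 p u) (o1 p v) (o2 p u) (o2 p v) => a b c d; ring.
Qed.

Lemma derive_surface_C w : class_C 3 D ('D_w x).
Proof. by have [_ +] := xC; apply. Qed.

Lemma dot_frame p : D p -> [/\ dot (e1 p) (e1 p) = 1, dot (e2 p) (e2 p) = 1,
  dot (e3 p) (e3 p) = 1 & [/\ dot (e1 p) (e2 p) = 0, dot (e1 p) (e3 p) = 0 &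
                              dot (e2 p) (e3 p) = 0]].
Proof. by move=> Dp; exact: frame_dot (frame_orthonormal frame Dp). Qed.

(** The square of [jac] is the squared length of the cross product of the coordinate tangent
    vectors, hence smooth. Differentiability of [jac], needed to take the root, comes from writing
    it as the inner product of that cross product with [e3]. *)
Lemma jac_C : class_C 3 D jac.
Proof.
have crC : class_C 3 D (fun p => cross ('D_u x p) ('D_v x p)).
  by apply: class_C_cross => //; exact: derive_surface_C.
apply: (class_C_sqrt oD) => [p Dp|p|]; last 1 first.
- apply: class_C_ext (class_C_dot oD crC crC) => // p Dp.
  rewrite cross_derive_surface// dotZl dotZr.
  by have [_ _ -> _] := dot_frame Dp; rewrite mulr1.
- have dcr := differentiable_dot (class_C_differentiable crC Dp) (frame_diff3 frame Dp).
  apply: (open_differentiable oD _ Dp dcr) => q Dq.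
  rewrite cross_derive_surface// dotZl.
  by have [_ _ -> _] := dot_frame Dq; rewrite mulr1.
- exact: jac_neq0.
Qed.

(** Dividing the cross product of the tangent vectors by [jac] recovers [e3], which raises it from
    differentiable to C^3. *)
Lemma normal_C : class_C 3 D e3.
Proof.
have crC : class_C 3 D (fun p => cross ('D_u x p) ('D_v x p)).
  by apply: class_C_cross => //; exact: derive_surface_C.
have jVC := class_CV oD jac_neq0 jac_C.
apply: class_C_ext (class_C_scale oD jVC crC) => // p Dp.
by rewrite cross_derive_surface// scalerA mulVf ?scale1r// jac_neq0.
Qed.

Lemma derive_normal_C w : class_C 2 D ('D_w e3).
Proof. by have [_ +] := normal_C; apply. Qed.

Lemma gauss_curvature_C : class_C 2 D (k1 * k2).
Proof.
have crC := class_C_cross oD (derive_normal_C u) (derive_normal_C v).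
have jVC := class_CV oD jac_neq0 (class_CW jac_C).
have := class_CM oD (class_C_dot oD crC (class_CW normal_C)) jVC.
apply: class_C_ext => // p Dp; rewrite !fctE cross_derive_normal// dotZl.
by have [_ _ -> _] := dot_frame Dp; rewrite mulr1 mulfK// jac_neq0.
Qed.

Lemma mean_curvature_C : class_C 2 D (k1 + k2).
Proof.
have crC1 := class_C_cross oD (derive_normal_C u) (class_CW (derive_surface_C v)).
have crC2 := class_C_cross oD (class_CW (derive_surface_C u)) (derive_normal_C v).
have jVC := class_CV oD jac_neq0 (class_CW jac_C).
have sC := class_CN oD (class_C_dot oD (class_CD oD crC1 crC2) (class_CW normal_C)).
apply: class_C_ext (class_CM oD sC jVC) => // p Dp.
rewrite !fctE cross_derive_mixed// dotZl.
by have [_ _ -> _] := dot_frame Dp; rewrite mulr1 opprK mulfK// jac_neq0.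
Qed.

(** Multiplying the Rodrigues relation by [omega x e] and summing over the coordinate vectors
    isolates [k] as a quotient of differentiable functions. Its denominator is a sum of two squares,
    nonzero because the form [omega x e] does not vanish. This provides the differentiability needed
    to extract [k1 - k2] from its square. *)
Lemma principal_curvature_differentiable e k :
  (forall p, D p -> differentiable e p) ->
  (forall p w, D p -> omega e3 e p w = - (k p * omega x e p w)) ->
  (forall p, D p -> exists w, omega x e p w = 1) ->
  forall p, D p -> differentiable k p.
Proof.
move=> de ke e0 p Dp.
have d y w : class_C 1 D ('D_w y) -> differentiable (fun q => omega y e q w) p.
  by move=> yC; apply: differentiable_dot (de _ Dp); exact: class_C_differentiable yC Dp.
have dx w := d x w (class_CW (class_CW (derive_surface_C w))).
have d3 w := d e3 w (class_CW (derive_normal_C w)).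
have sq0 q : D q -> omega x e q u ^+ 2 + omega x e q v ^+ 2 != 0.
  move=> Dq; have [w] := e0 _ Dq; rewrite omega_coord//.
  generalize (omega x e q u) (omega x e q v) => a b ab1.
  rewrite paddr_eq0 ?sqr_ge0// !sqrf_eq0; apply/andP => -[/eqP a0 /eqP b0].
  by move/eqP: ab1; rewrite a0 b0 !mulr0 addr0 eq_sym oner_eq0.
have dnum := differentiableD (differentiableM (d3 u) (dx u)) (differentiableM (d3 v) (dx v)).
have dden := differentiableD (differentiableM (dx u) (dx u)) (differentiableM (dx v) (dx v)).
have dk := differentiableN (differentiableM dnum (differentiableV dden (sq0 _ Dp))).
apply: (open_differentiable oD _ Dp dk) => q Dq.
change (- ((omega e3 e q u * omega x e q u + omega e3 e q v * omega x e q v)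
  * (omega x e q u * omega x e q u + omega x e q v * omega x e q v)^-1) = k q).
have := sq0 _ Dq; have := ke _ u Dq; have := ke _ v Dq.
generalize (omega x e q u) (omega x e q v) (omega e3 e q u) (omega e3 e q v).
by move=> a b a' b' -> ->; rewrite !expr2 => s0; field.
Qed.

Lemma omega_normal1 p w : D p -> omega e3 e1 p w = - (k1 p * o1 p w).
Proof.
move=> Dp; rewrite {1}/omega derive_normal// dotDl !dotZl.
by have [-> _ _ [d12 _ _]] := dot_frame Dp; rewrite [dot (e2 p) _]dotC d12 mulr1 mulr0 addr0.
Qed.

Lemma omega_normal2 p w : D p -> omega e3 e2 p w = - (k2 p * o2 p w).
Proof.
move=> Dp; rewrite {1}/omega derive_normal// dotDl !dotZl.
by have [_ -> _ [-> _ _]] := dot_frame Dp; rewrite mulr1 mulr0 add0r.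
Qed.

Lemma principal_curvatures_differentiable p : D p ->
  differentiable k1 p /\ differentiable k2 p.
Proof.
move=> Dp; split.
- apply: (principal_curvature_differentiable (frame_diff1 frame) omega_normal1) => // q Dq.
  by have [w [? [? _ _ _ _]]] := dual_basis Dq; exists w.
- apply: (principal_curvature_differentiable (frame_diff2 frame) omega_normal2) => // q Dq.
  by have [? [w [_ _ _ ? _]]] := dual_basis Dq; exists w.
Qed.

(* (k1 - k2)^2 = (k1 + k2)^2 - 4 k1 k2 *)
Lemma curvature_difference_C : class_C 2 D (k1 - k2).
Proof.
apply: (class_C_sqrt oD) => [p Dp|p Dp|].
- by have [? ?] := principal_curvatures_differentiable Dp; exact: differentiableB.
- by rewrite !fctE subr_eq0 nonumbilic.
have KC := class_CM oD (class_C_cst oD 2 (4 : R)) gauss_curvature_C.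
have TC := class_CM oD mean_curvature_C mean_curvature_C.
apply: class_C_ext (class_CB oD TC KC) => // p _.
rewrite !fctE /cst; ring.
Qed.

(** Half the sum of [k1 + k2] and [k1 - k2]. Order 2 makes the central surface C^2, as its second
    form requires. *)
Lemma principal_curvature1_C : class_C 2 D k1.
Proof.
have c2 := class_C_cst oD 2 (2^-1 : R).
have sC := class_CD oD mean_curvature_C curvature_difference_C.
by apply: class_C_ext (class_CM oD c2 sC) => // p _; rewrite !fctE /cst; field.
Qed.

(** * Skew-symmetry of the connection forms and the Codazzi equations *)

Context (d1k1 d2k1 d1k2 d2k2 : 'rV[R]_2 -> R).
Hypothesis dk1 : pfaffian_derivatives D x e1 e2 k1 d1k1 d2k1.
Hypothesis dk2 : pfaffian_derivatives D x e1 e2 k2 d1k2 d2k2.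

Lemma derive_dot_cst (f g : 'rV[R]_2 -> 'rV[R]_3) (c : R) p w :
  (forall q, D q -> differentiable f q) -> (forall q, D q -> differentiable g q) ->
  (forall q, D q -> dot (f q) (g q) = c) -> D p ->
  dot ('D_w f p) (g p) + dot (f p) ('D_w g p) = 0.
Proof.
move=> df dg fgc Dp.
have dfp : derivable f p w by exact/diff_derivable/df.
have dgp : derivable g p w by exact/diff_derivable/dg.
have [_ E] := is_derive_dot dfp dgp; rewrite -E.
have -> : 'D_w (fun q => dot (f q) (g q)) p = 'D_w (cst c) p.
  by apply: (open_derive oD).
by rewrite derive_cst.
Qed.

Lemma dot_derive_frame p w : D p ->
  [/\ omega e1 e1 p w = 0, omega e2 e2 p w = 0 &
      omega e2 e1 p w = - omega e1 e2 p w].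
Proof.
move=> Dp.
have h1 := @derive_dot_cst e1 e1 1 p w (frame_diff1 frame) (frame_diff1 frame).
have h2 := @derive_dot_cst e2 e2 1 p w (frame_diff2 frame) (frame_diff2 frame).
have h3 := @derive_dot_cst e1 e2 0 p w (frame_diff1 frame) (frame_diff2 frame).
have d11 q : D q -> dot (e1 q) (e1 q) = 1 by case/dot_frame.
have d22 q : D q -> dot (e2 q) (e2 q) = 1 by case/dot_frame.
have d12 q : D q -> dot (e1 q) (e2 q) = 0 by case/dot_frame=> _ _ _ [].
split.
- have := h1 d11 Dp.
  by rewrite [X in _ + X]dotC -mulr2n => /eqP; rewrite mulrn_eq0 => /eqP.
- have := h2 d22 Dp.
  by rewrite [X in _ + X]dotC -mulr2n => /eqP; rewrite mulrn_eq0 => /eqP.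
- have := h3 d12 Dp.
  by rewrite [X in _ + X]dotC addrC => /eqP; rewrite addr_eq0 => /eqP.
Qed.

(* Differentiating Rodrigues' formula <de3(w), e> = - k <dx(w), e> along w' and
   antisymmetrizing in (w, w') eliminates the second derivatives of x and e3. *)
Lemma codazzi_principal (e : 'rV[R]_2 -> 'rV[R]_3) (k : 'rV[R]_2 -> R) p w w' :
  (forall q, D q -> differentiable e q) -> (forall q, D q -> differentiable k q) ->
  (forall q w, D q -> omega e3 e q w = - (k q * omega x e q w)) -> D p ->
  dot ('D_w e3 p) ('D_w' e p) - dot ('D_w' e3 p) ('D_w e p)
  = 'D_w k p * omega x e p w' - 'D_w' k p * omega x e p w
    - k p * (dot ('D_w x p) ('D_w' e p) - dot ('D_w' x p) ('D_w e p)).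
Proof.
move=> de dk ke Dp.
have key v1 v2 : dot ('D_v2 ('D_v1 e3) p) (e p) + dot ('D_v1 e3 p) ('D_v2 e p)
    = - (k p * (dot ('D_v2 ('D_v1 x) p) (e p) + dot ('D_v1 x p) ('D_v2 e p))
         + omega x e p v1 * 'D_v2 k p).
  have d3 := class_C_differentiable (derive_normal_C v1) Dp.
  have dx := class_C_differentiable (derive_surface_C v1) Dp.
  have d3' : derivable ('D_v1 e3) p v2 by exact/diff_derivable/d3.
  have dx' : derivable ('D_v1 x) p v2 by exact/diff_derivable/dx.
  have de' : derivable e p v2 by exact/diff_derivable/de.
  have dk' : derivable k p v2 by exact/diff_derivable/dk.
  have [_ E3] := is_derive_dot d3' de'.
  have [_ Ex] := is_deriveN (is_deriveM (derivableP dk') (is_derive_dot dx' de')).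
  apply: (etrans (esym E3)); apply: (etrans _ Ex).
  by apply: (open_derive oD) => // q Dq; exact: ke.
have := key w w'; have := key w' w.
rewrite (derive_row_comm w w' oD (class_CW normal_C) Dp).
rewrite (derive_row_comm w w' oD (class_CW (class_CW xC)) Dp).
generalize (dot ('D_w' ('D_w e3) p) (e p)) (dot ('D_w' ('D_w x) p) (e p)).
generalize (dot ('D_w e3 p) ('D_w' e p)) (dot ('D_w' e3 p) ('D_w e p)).
generalize (dot ('D_w x p) ('D_w' e p)) (dot ('D_w' x p) ('D_w e p)).
generalize (omega x e p w) (omega x e p w') ('D_w k p) ('D_w' k p) (k p).
move=> a a' b b' c f f' g g' h h'.
by move=> E1 E2; lra.
Qed.

(** Both sides are linear in [w], so the dual basis suffices. The relation for [(e1, k1)] gives the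
    value at [w1], and the one for [(e2, k2)] the value at [w2]. *)
Lemma codazzi p w : D p ->
  (k1 p - k2 p) * omega e1 e2 p w = d2k1 p * o1 p w + d1k2 p * o2 p w.
Proof.
move=> Dp; have [w1 [w2 [a1 b1 a2 b2 wE]]] := dual_basis Dp.
have k1d q : D q -> differentiable k1 q by case/principal_curvatures_differentiable.
have k2d q : D q -> differentiable k2 q by case/principal_curvatures_differentiable.
have dotx e v1 v2 : dot ('D_v1 x p) ('D_v2 e p)
    = o1 p v1 * omega e e1 p v2 + o2 p v1 * omega e e2 p v2.
  rewrite derive_surface//; apply: (etrans (dot_comb _ _ _ _ _)).
  by rewrite (dotC (e1 p)) (dotC (e2 p)).
have dotn e v1 v2 : dot ('D_v1 e3 p) ('D_v2 e p)
    = - (k1 p * o1 p v1) * omega e e1 p v2 + - (k2 p * o2 p v1) * omega e e2 p v2.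
  rewrite derive_normal//; apply: (etrans (dot_comb _ _ _ _ _)).
  by rewrite (dotC (e1 p)) (dotC (e2 p)).
have o12 : omega e1 e2 p w = o1 p w * omega e1 e2 p w1 + o2 p w * omega e1 e2 p w2.
  rewrite {1}(wE w).
  have de := derive_lin (o1 p w) (o2 p w) w1 w2 (frame_diff1 frame Dp).
  exact: (etrans (congr1 (fun a => dot a (e2 p)) de) (dot_comb _ _ _ _ _)).
have C1 : (k1 p - k2 p) * omega e1 e2 p w1 = d2k1 p.
  have [r1 _ _] := dot_derive_frame w1 Dp; have [r2 _ _] := dot_derive_frame w2 Dp.
  have := codazzi_principal w1 w2 (frame_diff1 frame) k1d omega_normal1 Dp.
  move: a1 b1 a2 b2 r1 r2 (dotn e1 w1 w2) (dotn e1 w2 w1) (dotx e1 w1 w2) (dotx e1 w2 w1).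
  move: (dk1 w1 Dp) (dk1 w2 Dp).
  generalize (dot ('D_w1 e3 p) ('D_w2 e1 p)) (dot ('D_w2 e3 p) ('D_w1 e1 p)).
  generalize (dot ('D_w1 x p) ('D_w2 e1 p)) (dot ('D_w2 x p) ('D_w1 e1 p)).
  generalize ('D_w1 k1 p) ('D_w2 k1 p) (omega e1 e1 p w1) (omega e1 e1 p w2).
  generalize (omega e1 e2 p w1) (omega e1 e2 p w2) (o1 p w1) (o1 p w2) (o2 p w1) (o2 p w2).
  move=> b b' x1 x1' x2 x2' f f' r r' X X' N N' -> -> -> -> -> -> -> -> -> -> -> -> E.
  by clear dotx dotn wE o12 k1d k2d; lra.
have C2 : (k1 p - k2 p) * omega e1 e2 p w2 = d1k2 p.
  have [_ r1 t1] := dot_derive_frame w1 Dp; have [_ r2 t2] := dot_derive_frame w2 Dp.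
  have := codazzi_principal w1 w2 (frame_diff2 frame) k2d omega_normal2 Dp.
  move: a1 b1 a2 b2 r1 r2 t1 t2 (dotn e2 w1 w2) (dotn e2 w2 w1) (dotx e2 w1 w2) (dotx e2 w2 w1).
  move: (dk2 w1 Dp) (dk2 w2 Dp).
  generalize (dot ('D_w1 e3 p) ('D_w2 e2 p)) (dot ('D_w2 e3 p) ('D_w1 e2 p)).
  generalize (dot ('D_w1 x p) ('D_w2 e2 p)) (dot ('D_w2 x p) ('D_w1 e2 p)).
  generalize ('D_w1 k2 p) ('D_w2 k2 p) (omega e2 e2 p w1) (omega e2 e2 p w2).
  generalize (omega e2 e1 p w1) (omega e2 e1 p w2).
  generalize (omega e1 e2 p w1) (omega e1 e2 p w2) (o1 p w1) (o1 p w2) (o2 p w1) (o2 p w2).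
  move=> b b' x1 x1' x2 x2' t t' f f' r r' X X' N N'.
  move=> -> -> -> -> -> -> -> -> -> -> -> -> -> -> E.
  by clear dotx dotn wE o12 k1d k2d C1; lra.
rewrite o12 -C1 -C2.
by generalize (omega e1 e2 p w1) (omega e1 e2 p w2) (o1 p w) (o2 p w) => *; ring.
Qed.

(** * The first central surface: tangent plane, normal and second fundamental form *)

Hypothesis k1_neq0 : forall p, D p -> k1 p != 0.
Hypothesis d1k1_neq0 : forall p, D p -> d1k1 p != 0.

Local Notation y1 := (central_surface x e3 k1).

Lemma central_surface_C : class_C 2 D y1.
Proof.
have kVC := class_CV oD k1_neq0 principal_curvature1_C.
have yC := class_CD oD (class_CW (class_CW xC)) (class_C_scale oD kVC (class_CW normal_C)).
exact: class_C_ext yC.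
Qed.

(** The [e1] components of [dx] and of [de3 / k1] cancel, so the tangent vectors lie in the span of
    [e2] and [e3]. *)
Lemma derive_central_surface p w : D p ->
  'D_w y1 p = ((1 - k2 p / k1 p) * o2 p w) *: e2 p
    + (- (k1 p ^- 2) * (d1k1 p * o1 p w + d2k1 p * o2 p w)) *: e3 p.
Proof.
move=> Dp.
have dk : derivable k1 p w.
  by apply: diff_derivable; have [] := principal_curvatures_differentiable Dp.
have dx : derivable x p w by exact/diff_derivable/surface_differentiable.
have d3 : derivable e3 p w by exact: (diff_derivable (frame_diff3 frame Dp)).
have dkV := derivableV (k1_neq0 Dp) dk.
have [_ E] := is_deriveD (derivableP dx) (is_derive_scale dkV d3).
apply: (etrans E); rewrite deriveV ?k1_neq0// dk1//.
rewrite derive_surface// derive_normal//.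
generalize (o1 p w) (o2 p w) (k1_neq0 Dp) => a b k0.
apply/rowP => i; rewrite !mxE /GRing.scale /=.
by field.
Qed.

Lemma unit_normal_central_surface p : D p ->
  exists2 s, s != 0 & unit_normal y1 p = s *: e1 p.
Proof.
(* The coefficient of [e1] in the cross product; the terms in [d2k1] cancel in the determinant. It
   is nonzero because [k1 != k2] and [d1k1 != 0]. *)
move=> Dp; pose mu := (1 - k2 p / k1 p) * k1 p ^- 2 * d1k1 p * jac p.
have nE : cross ('D_u y1 p) ('D_v y1 p) = mu *: e1 p.
  apply: (etrans (congr2 cross (derive_central_surface u Dp) (derive_central_surface v Dp))).
  apply: (etrans (cross_comb _ _ _ _ _ _)).
  rewrite (frame_cross23 (frame_orthonormal frame Dp) (frame_oriented frame Dp)).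
  congr (_ *: _); rewrite /mu /jac.
  by generalize (o1 p u) (o1 p v) (o2 p u) (o2 p v) => a b c d; ring.
have mu0 : mu != 0.
  rewrite /mu !mulf_neq0 ?jac_neq0 ?d1k1_neq0 ?invr_neq0 ?expf_neq0 ?k1_neq0//.
  rewrite subr_eq0 eq_sym; apply/eqP => /divr1_eq E.
  by have := nonumbilic Dp; rewrite E eqxx.
exists ((Num.sqrt (mu * mu))^-1 * mu).
  by rewrite mulf_neq0// invr_neq0// -expr2 sqrtr_sqr normr_eq0.
rewrite /unit_normal nE /= dotZl dotZr scalerA.
by have [-> _ _ _] := dot_frame Dp; rewrite mulr1.
Qed.

Lemma second_form_central_surface p : D p -> exists2 lambda, lambda != 0 &
  forall w, second_form y1 p w
    = lambda * (d1k1 p * o1 p w ^+ 2 - d1k2 p * o2 p w ^+ 2).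
Proof.
move=> Dp; have [s s0 nE] := unit_normal_central_surface Dp.
exists (s / k1 p); first by rewrite mulf_neq0// invr_neq0// k1_neq0.
move=> w; rewrite /second_form nE dotZr -mulrA; congr (s * _).
have dyC : class_C 1 D ('D_w y1) by have [_ +] := central_surface_C; apply.
have dy q : D q -> differentiable ('D_w y1) q by exact: class_C_differentiable dyC.
have tangent q : D q -> dot ('D_w y1 q) (e1 q) = 0.
  move=> Dq; apply: (etrans (congr1 (fun a => dot a (e1 q)) (derive_central_surface w Dq))).
  apply: (etrans (dot_comb _ _ _ _ _)).
  have [_ _ _ [d12 d13 _]] := dot_frame Dq.
  by rewrite ![dot _ (e1 q)]dotC d12 d13 !mulr0 addr0.
(* Differentiating [<dy, e1> = 0] replaces the second derivative of [y1] by [- <dy, de1>], which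
   involves only first derivatives. *)
have /eqP := @derive_dot_cst ('D_w y1) e1 0 p w dy (frame_diff1 frame) tangent Dp.
rewrite addr_eq0 => /eqP ->.
have [_ _ _ [_ d13 _]] := dot_frame Dp.
have t1 := @derive_dot_cst e1 e3 0 p w (frame_diff1 frame) (frame_diff3 frame).
have d13' q : D q -> dot (e1 q) (e3 q) = 0 by case/dot_frame=> _ _ _ [].
have {t1} := t1 d13' Dp.
rewrite [X in _ + X]dotC -/(omega e3 e1 p w) omega_normal1// => /eqP.
rewrite subr_eq0 => /eqP t13.
have yE : dot ('D_w y1 p) ('D_w e1 p) = (1 - k2 p / k1 p) * o2 p w * omega e1 e2 p w
   - k1 p ^- 2 * (d1k1 p * o1 p w + d2k1 p * o2 p w) * (k1 p * o1 p w).
  apply: (etrans (congr1 (fun a => dot a ('D_w e1 p)) (derive_central_surface w Dp))).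
  apply: (etrans (dot_comb _ _ _ _ _)).
  by rewrite ![dot _ ('D_w e1 p)]dotC t13 -/(omega e1 e2 p w) !mulNr.
rewrite yE.
(* The Codazzi equation solved for [omega_12]; the terms in [d2k1] then cancel, and only the two
   squares remain. *)
have -> : omega e1 e2 p w = (d2k1 p * o1 p w + d1k2 p * o2 p w) / (k1 p - k2 p).
  by rewrite -codazzi// mulrC mulKf// subr_eq0 nonumbilic.
have := nonumbilic Dp; rewrite -subr_eq0; have := k1_neq0 Dp.
generalize (o1 p w) (o2 p w) => a b k0 k120.
by field; rewrite k0.
Qed.

Lemma asymptotic_net_central_surface :
  asymptotic_net D x e1 e2 y1 (Net d1k1 (fun=> 0) (fun p => - d1k2 p)).
Proof.
(* The factor is chosen point by point; outside [D] the value 0 is a placeholder. *)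
have H p : exists l, D p -> l != 0 /\ forall w, second_form y1 p w
    = l * (d1k1 p * o1 p w ^+ 2 - d1k2 p * o2 p w ^+ 2).
  have [Dp|nDp] := pselect (D p); last by exists 0.
  by have [l l0 lE] := second_form_central_surface Dp; exists l.
have [l lP] := choice H.
exists l => [p /lP[]//|p w /lP[_ ->]].
by rewrite /net_form /=; congr (_ * _); ring.
Qed.

End Surface.

(** * Exchange of the two principal directions *)

(** The sign in [- e1] preserves the orientation of the frame, and leaves [k1] unchanged since
    Rodrigues' formula is linear in the direction. Results on the first central surface thus apply
    to the second. *)
Lemma principal_frame_swap {R : realType} (D : set 'rV[R]_2)
    (x e1 e2 e3 : 'rV[R]_2 -> 'rV[R]_3) (k1 k2 : 'rV[R]_2 -> R) :
  (forall p, D p -> differentiable x p) ->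
  principal_frame D x e1 e2 e3 k1 k2 -> principal_frame D x e2 (- e1) e3 k2 k1.
Proof.
move=> dx [d1 d2 d3 on or nrm p1 p2].
have nE p : (- e1) p = - e1 p by [].
split; [exact: d2| |exact: d3| | |exact: nrm|exact: p2|].
- by move=> p Dp; apply/differentiableN/d1.
- move=> p Dp; have [d11 d22 d33 [d12 d13 d23]] := frame_dot (on p Dp).
  have d21 : dot (e2 p) (e1 p) = 0 by rewrite dotC.
  have d31 : dot (e3 p) (e1 p) = 0 by rewrite dotC.
  have d32 : dot (e3 p) (e2 p) = 0 by rewrite dotC.
  apply/matrixP => i j; rewrite rows3_gram mxE nE -val_eqE.
  case: i => -[|[|[|//]]] ?; case: j => -[|[|[|//]]] ? /=;
    by rewrite ?dotNl ?dotNr ?d11 ?d22 ?d33 ?d12 ?d13 ?d23 ?d21 ?d31 ?d32 ?opprK ?oppr0.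
- move=> p Dp; rewrite nE -(or p Dp) !det3 !mxE /= ?mxE; ring.
- move=> p Dp; have [w [xw nw]] := p1 p Dp; exists (- w).
  have DN (f : 'rV[R]_2 -> 'rV[R]_3) : differentiable f p -> 'D_(- w) f p = - 'D_w f p.
    by move=> df; rewrite !deriveE// linearN.
  by rewrite (DN _ (dx p Dp)) (DN _ (d3 p Dp)) xw nw nE scalerN.
Qed.

(** * The functional relation between the principal curvatures *)

(** The relation is [F(a, b) = 1/a - 1/b - c] on the open set where both coordinates are nonzero.
    Its partial derivative in [a] is [- 1/a^2], which never vanishes. *)
Lemma Weingarten_inv_sub {R : realType} (D : set 'rV[R]_2) (k1 k2 : 'rV[R]_2 -> R) c :
  (forall p, D p -> k1 p != 0) -> (forall p, D p -> k2 p != 0) ->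
  (forall p, D p -> (k1 p)^-1 - (k2 p)^-1 = c) -> Weingarten D k1 k2.
Proof.
move=> k10 k20 kc.
pose O := [set q : 'rV[R]_2 | q 0 0 != 0 /\ q 0 1 != 0].
have oO : open O.
  have oi (i : 'I_2) : open [set q : 'rV[R]_2 | q 0 i != 0].
    apply: (@open_comp _ _ (fun q : 'rV[R]_2 => q 0 i) [set y | y != 0]).
      by move=> q _; exact: coord_continuous.
    exact: open_neq.
  exact: (openI (oi 0) (oi 1)).
have idC n : class_C n O (@id 'rV[R]_2).
  case: n => [|n]; first by move=> p _; exact: cvg_id.
  split=> [p _|w]; first exact/ex_diff.
  by apply: (class_C_ext oO) (class_C_cst oO n w) => p _; rewrite derive_id.
have coC n i := class_C_row_coord i oO (idC n).
exists O, (fun q => (q 0 0)^-1 - (q 0 1)^-1 - c); split=> //.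
  have c0 := class_CV oO (fun p (Op : O p) => Op.1) (coC 1 0).
  have c1 := class_CV oO (fun p (Op : O p) => Op.2) (coC 1 1).
  exact: (class_CB oO (class_CB oO c0 c1) (class_C_cst oO 1 c)).
move=> p Dp q; have q0 : q 0 0 = k1 p by rewrite mxE.
have q1 : q 0 1 = k2 p by rewrite mxE.
split; [by rewrite /O /= q0 q1 k10 ?k20|by rewrite q0 q1 kc ?subrr|].
exists (delta_mx 0 0).
set h := delta_mx 0 0.
have dV (i : 'I_2) : q 0 i != 0 ->
    is_derive q h (fun r : 'rV[R]_2 => (r 0 i)^-1) (- (q 0 i) ^- 2 *: h 0 i).
  move=> qi0; have di : derivable (@id 'rV[R]_2) q h by exact: derivable_id.
  have idh : 'D_h (@id 'rV[R]_2) q = h by exact: derive_id.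
  have dc := derivable_row_coord (i := i) di.
  split; first exact: derivableV qi0 dc.
  have hE := derive_row_coord i di.
  by rewrite deriveV// -[in RHS]idh hE.
have q00 : q 0 0 != 0 by rewrite q0 k10.
have q10 : q 0 1 != 0 by rewrite q1 k20.
have [_ E] := is_deriveB (is_deriveB (dV 0 q00) (dV 1 q10)) (is_derive_cst c q h).
apply/eqP => /(etrans (esym E)); rewrite !mxE /= scaler0 !subr0.
by apply/eqP; rewrite /GRing.scale/= mulr1 oppr_eq0 invr_neq0// expf_neq0// k10.
Qed.

(** * The two asymptotic nets, their spherical images and the orthogonality criterion *)

Theorem proposition4 (R : realType) (r : nat) (D : set 'rV[R]_2)
  (x e1 e2 e3 : 'rV[R]_2 -> 'rV[R]_3) (k1 k2 : 'rV[R]_2 -> R)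
  (* dk_i = d1k_i omega_1 + d2k_i omega_2 *)
  (d1k1 d2k1 d1k2 d2k2 : 'rV[R]_2 -> R)
  (hr : (4 <= r)%N)
  (hx : regular_surface r D x)
  (hframe : principal_frame D x e1 e2 e3 k1 k2)
  (hk1 : pfaffian_derivatives D x e1 e2 k1 d1k1 d2k1)
  (hk2 : pfaffian_derivatives D x e1 e2 k2 d1k2 d2k2)
  (hparabolic : forall p, D p -> k1 p * k2 p != 0)
  (hcanal : forall p, D p -> [/\ k1 p != k2 p, d1k1 p != 0 & d2k2 p != 0]) :
  let y1 := central_surface x e3 k1 in
  let y2 := central_surface x e3 k2 in
  let N1 := Net d1k1 (fun=> 0) (fun p => - d1k2 p) in
  let N2 := Net d2k1 (fun=> 0) (fun p => - d2k2 p) in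
  let S1 := Net (fun p => d1k1 p / k1 p ^+ 2) (fun=> 0)
                (fun p => - (d1k2 p / k2 p ^+ 2)) in
  let S2 := Net (fun p => d2k1 p / k1 p ^+ 2) (fun=> 0)
                (fun p => - (d2k2 p / k2 p ^+ 2)) in
  [/\ asymptotic_net D x e1 e2 y1 N1 /\ asymptotic_net D x e1 e2 y2 N2,
      spherical_image D x e1 e2 e3 N1 S1 /\ spherical_image D x e1 e2 e3 N2 S2 &
      (orthogonal_spherical_net D S1 /\ orthogonal_spherical_net D S2) <->
      (Weingarten D k1 k2 /\
       exists c : R, forall p, D p -> (k1 p)^-1 - (k2 p)^-1 = c)].
Proof.
move=> y1 y2 N1 N2 S1 S2.
have [oD cD xCr xreg] := hx.
have xC := class_C_leq hr xCr.
have k10 p : D p -> k1 p != 0 by move/hparabolic; rewrite mulf_eq0 negb_or => /andP[].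
have k20 p : D p -> k2 p != 0 by move/hparabolic; rewrite mulf_eq0 negb_or => /andP[].
have k12 p : D p -> k1 p != k2 p by case/hcanal.
have k21 p : D p -> k2 p != k1 p by move=> Dp; rewrite eq_sym k12.
have n1 p : D p -> d1k1 p != 0 by case/hcanal.
have n2 p : D p -> d2k2 p != 0 by case/hcanal.
have dx p : D p -> differentiable x p by exact: class_C_differentiable xC.
split.
- split.
    exact: (asymptotic_net_central_surface oD xC xreg hframe k12 hk1 hk2 k10 n1).
  have frame' := principal_frame_swap dx hframe.
  have oN p w : omega x (- e1) p w = - omega x e1 p w.
    exact: dotNr.
  (* In the rotated frame the Pfaffian derivatives [(f1, f2)] become [(f2, - f1)]. *)
  have hk1' : pfaffian_derivatives D x e2 (- e1) k1 d2k1 (- d1k1).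
    by move=> p w Dp; rewrite hk1// oN mulrNN addrC.
  have hk2' : pfaffian_derivatives D x e2 (- e1) k2 d2k2 (- d1k2).
    by move=> p w Dp; rewrite hk2// oN mulrNN addrC.
  have [l l0 lE] := asymptotic_net_central_surface oD xC xreg frame' k21 hk2' hk1' k20 n2.
  (* The rotated frame yields [d2k2 omega_2^2 - d2k1 omega_1^2], the opposite of the form of [N2];
     hence the sign. *)
  exists (fun p => - l p) => [p Dp|p w Dp]; first by rewrite oppr_eq0 l0.
  rewrite lE// /net_form /= oN.
  by generalize (omega x e1 p w) (omega x e2 p w) => a b; ring.
- have on1 := omega_normal1 xC xreg hframe.
  have on2 := omega_normal2 xC xreg hframe.
  (* The forms agree exactly: squaring [omega_3i = - k_i omega_i] produces the [k_i^2] that cancels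
     the denominators of [S1] and [S2]. *)
  split; exists (fun=> 1) => [p _|p w Dp]; rewrite ?oner_neq0//.
  + rewrite /net_form /= on1// on2//.
    generalize (omega x e1 p w) (omega x e2 p w) => a b.
    by field; rewrite k10 ?k20.
  + rewrite /net_form /= on1// on2//.
    generalize (omega x e1 p w) (omega x e2 p w) => a b.
    by field; rewrite k10 ?k20.
have kd p := principal_curvatures_differentiable oD xC xreg hframe (p := p).
pose f p := (k1 p)^-1 - (k2 p)^-1.
have df p : D p -> differentiable f p.
  move=> Dp; have [d1 d2] := kd p Dp.
  by apply: (differentiableB (differentiableV d1 (k10 p Dp)) (differentiableV d2 (k20 p Dp))).
(* The Pfaffian derivatives of [1/k1 - 1/k2] are minus the traces of [S1] and [S2], so both nets are
   orthogonal exactly when [df = 0] on [D]. *)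
have Df p w : D p -> 'D_w f p =
    - (netA S1 p + netC S1 p) * omega x e1 p w - (netA S2 p + netC S2 p) * omega x e2 p w.
  move=> Dp; have [/(diff_derivable (v := w)) d1 /(diff_derivable (v := w)) d2] := kd p Dp.
  have E := deriveB (derivableV (k10 p Dp) d1) (derivableV (k20 p Dp) d2).
  apply: (etrans E); rewrite !deriveV ?k10 ?k20// hk1// hk2// /=.
  generalize (omega x e1 p w) (omega x e2 p w) => a b.
  by rewrite /GRing.scale /=; field; rewrite k10 ?k20.
split=> [[s1 s2]|[_ [c kc]]].
- have f0 p w : D p -> 'D_w f p = 0.
    by move=> Dp; rewrite Df// s1// s2// oppr0 !mul0r subr0.
  have [c kc] : exists c : R, forall p, D p -> f p = c.
    (* On an empty domain any constant will do. *)
    have [[p Dp]|D0] := pselect (D !=set0).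
      by exists (f p) => q Dq; exact: (derive0_constant oD cD df f0).
    by exists 0 => p Dp; case: D0; exists p.
  by split; [exact: (Weingarten_inv_sub k10 k20 kc)|exists c].
- have f0 p w : D p -> 'D_w f p = 0.
    move=> Dp; apply: etrans (derive_cst c p w).
    by apply: (open_derive oD) => // q Dq; exact: kc.
  (* Evaluating [df = 0] on the dual basis isolates one trace at a time. *)
  split=> p Dp; have [w1 [w2 [a1 b1 a2 b2 _]]] := dual_basis xC xreg hframe Dp.
  + have := f0 p w1 Dp; rewrite Df// a1 b1 mulr1 mulr0 subr0 => /eqP.
    by rewrite oppr_eq0 => /eqP.
  + have := f0 p w2 Dp; rewrite Df// a2 b2 mulr1 mulr0 add0r => /eqP.
    by rewrite oppr_eq0 => /eqP.
Qed.
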